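(* Let $n$ and $m$ be nonnegative integers, and let $i\in\{1,2,\ldots,n\}$. Then there exists a polynomial $P_{n,i,m}$ with integer coefficients in $2^{n}$ indeterminates that is independent of $R$ and $A$, and that has the following property: If $A$ is any $n\times n$-matrix over any commutative ring $R$, then the $i$-th diagonal entry $(A^{m})_{i,i}$ of $A^{m}$ can be obtained by substituting the $2^n$ principal minors of $A$ into $P_{n,i,m}$. In particular, the principal minors of $A$ uniquely determine this entry.
   Context: Rings are unital. For an $n\times n$-matrix $A$ and a subset $I$ of $\{1,2,\ldots,n\}$, let $\operatorname{sub}_I^I A$ denote the principal submatrix of $A$ obtained by keeping only the rows and columns indexed by the elements of $I$ (in increasing order). A principal minor of $A$ is a determinant $\det(\operatorname{sub}_I^I A)$ for some $I\subseteq\{1,2,\ldots,n\}$; for $I=\varnothing$ this is the determinant of the $0\times 0$-matrix, which is $1$. Thus there are $2^n$ principal minors, one for each subset $I$. The principal minors are substituted for the $2^n$ indeterminates according to a numbering of the subsets $I$ of $\{1,2,\ldots,n\}$ that is fixed once and for all, independently of $R$ and $A$ (equivalently, the indeterminates are indexed by the subsets $I$, and $\det(\operatorname{sub}_I^I A)$ is substituted for the indeterminate indexed by $I$). $B_{i,j}$ denotes the $(i,j)$-th entry of a matrix $B$. *)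

(* Defs.v *)
From mathcomp Require Import all_boot all_order all_algebra.
From mathcomp Require Import mpoly.

Set Implicit Arguments.
Unset Strict Implicit.
Unset Printing Implicit Defensive.

Import GRing.Theory.
Local Open Scope ring_scope.

(* [enum_val : 'I_#|I| -> 'I_n] lists the elements of [I] in increasing order. *)
Definition principal_submx (R : comPzRingType) (n : nat) (I : {set 'I_n})
    (A : 'M[R]_n) : 'M[R]_#|I| :=
  mxsub (fun k : 'I_#|I| => enum_val k) (fun k : 'I_#|I| => enum_val k) A.

Definition principal_minor (R : comPzRingType) (n : nat) (I : {set 'I_n})
    (A : 'M[R]_n) : R :=
  \det (principal_submx I A).

Lemma card_subsets_ord (n : nat) : #|{set 'I_n}| = (2 ^ n)%N.
Proof. by rewrite -cardsT -powersetT card_powerset cardsT card_ord. Qed.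

(* The fixed numbering of the subsets of 'I_n; it depends on [n] only. *)
Definition numbered_subset (n : nat) (k : 'I_(2 ^ n)) : {set 'I_n} :=
  enum_val (cast_ord (esym (card_subsets_ord n)) k).

Lemma numbered_subset_bij (n : nat) : bijective (@numbered_subset n).
Proof.
exists (fun I => cast_ord (card_subsets_ord n) (enum_rank I)) => [k|I].
  by rewrite /numbered_subset enum_valK cast_ordKV.
by rewrite /numbered_subset cast_ordK enum_rankK.
Qed.

(* [mmap intr] is only available over nonzero rings; this is the same formula
   over every commutative ring, the zero ring included. *)
Definition subst_mpoly (R : comPzRingType) (N : nat) (x : 'I_N -> R)
    (P : {mpoly int[N]}) : R :=
  \sum_(u <- msupp P) (P@_u)%:~R * \prod_(k < N) x k ^+ u k.

Lemma subst_mpolyE (R : comNzRingType) (N : nat) (x : 'I_N -> R)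
    (P : {mpoly int[N]}) : subst_mpoly x P = mmap intr x P.
Proof. by []. Qed.

(* Main.v *)
Require Import Defs.
From HB Require Import structures.
From mathcomp Require Import all_boot all_order all_fingroup all_algebra.
From mathcomp Require Import mpoly.

Set Implicit Arguments.
Unset Strict Implicit.
Unset Printing Implicit Defensive.

Import GRing.Theory.

Local Open Scope ring_scope.

(** Over [R[X]], Cramer's rule gives
    [sum_m X^m (A^m)_{i,i} = adj(1 - X A)_{i,i} / det(1 - X A)].
    Numerator and denominator both have the form [det(1 + diag(d) A)], which
    expands as [sum_I (prod_{k in I} d_k) det(sub_I^I A)]; the denominator has
    constant term 1, so its inverse modulo [X^(m+1)] is a truncated geometric
    series, and the coefficient of [X^m] is an integer polynomial in the
    principal minors. *)

Section PrincipalMinors.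

Variable R : comNzRingType.

(** An injection between index sets of equal size is a permutation; it acts on both rows and
    columns, so its sign occurs twice and cancels. The propositional equation [p = n] allows for
    sizes that are not convertible, such as [#|I| + #|~: I|] and [n]. *)
Lemma det_mxsub_inj (p n : nat) (f : 'I_p -> 'I_n) (A : 'M[R]_n) :
  p = n -> injective f -> \det (mxsub f f A) = \det A.
Proof.
move=> eq_pn; case: n / eq_pn f A => f A injf.
pose s := perm injf.
have -> : mxsub f f A = row_perm s (col_perm s A).
  by apply/matrixP=> k l; rewrite !mxE !permE.
rewrite row_permE col_permE !det_mulmx !det_perm odd_permV mulrCA.
by rewrite -signr_addb addbb mulr1.
Qed.

(** Listing [I] first and its complement second makes the matrix block upper triangular, with the
    principal submatrix and an identity block on the diagonal. *)
Lemma det_row_restrict (n : nat) (I : {set 'I_n}) (B : 'M[R]_n) :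
  \det (\matrix_(k, l) (if k \in I then B k l else (k == l)%:R)) =
  principal_minor I B.
Proof.
set C := (X in \det X).
pose f (k : 'I_(#|I| + #|~: I|)) : 'I_n :=
  match split k with inl a => enum_val a | inr b => enum_val b end.
have fl a : f (lshift _ a) = enum_val a.
  by rewrite /f -[lshift _ a]/(unsplit (inl _ a)) unsplitK.
have fr b : f (rshift _ b) = enum_val b.
  by rewrite /f -[rshift _ b]/(unsplit (inr _ b)) unsplitK.
have inl_ (a : 'I_#|I|) : enum_val a \in I by apply: enum_valP.
have inr_ (b : 'I_#|~: I|) : (enum_val b \in I) = false.
  by apply/negbTE; have := enum_valP b; rewrite inE.
have neq_lr (a : 'I_#|I|) (b : 'I_#|~: I|) : enum_val b == enum_val a = false.
  by apply: contraFF (inr_ b) => /eqP->.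
have injf : injective f.
  move=> k l; rewrite -[k]splitK -[l]splitK.
  case: (split k) (split l) => [a|b] [a'|b'] /=; rewrite ?fl ?fr.
  - by move/enum_val_inj->.
  - by move/esym/eqP; rewrite neq_lr.
  - by move/eqP; rewrite neq_lr.
  - by move/enum_val_inj->.
have card_n : (#|I| + #|~: I| = n)%N by rewrite cardsC card_ord.
rewrite -(det_mxsub_inj C card_n injf) -[mxsub f f C]submxK.
have -> : dlsubmx (mxsub f f C) = 0.
  by apply/matrixP=> b a; rewrite !mxE fl fr inr_ neq_lr.
have -> : drsubmx (mxsub f f C) = 1%:M.
  by apply/matrixP=> b b'; rewrite !mxE !fr inr_ (inj_eq enum_val_inj).
rewrite det_ublock det1 mulr1; congr (\det _).
by apply/matrixP=> a a'; rewrite !mxE !fl inl_.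
Qed.

(** In each product of the Leibniz formula, expand over the set [I] of rows whose factor comes from
    [B], the other rows contributing the identity; then sum over permutations first. *)
Lemma det_add1 (n : nat) (B : 'M[R]_n) :
  \det (1%:M + B) = \sum_(I : {set 'I_n}) principal_minor I B.
Proof.
under [RHS]eq_bigr => I _ do rewrite -det_row_restrict.
rewrite /determinant exchange_big /=; apply: eq_bigr => s _.
rewrite -mulr_sumr; congr (_ * _).
under eq_bigr => k _ do rewrite !mxE addrC.
rewrite bigA_distr; apply: eq_big => [I|I _]; first by rewrite inE.
by apply: eq_bigr => k _; rewrite mxE.
Qed.

Lemma principal_minor_diag_mul (n : nat) (I : {set 'I_n}) (d : 'rV[R]_n)
    (A : 'M[R]_n) :
  principal_minor I (diag_mx d *m A) =
  (\prod_(k in I) d 0 k) * principal_minor I A.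
Proof.
rewrite /principal_minor big_enum_val.
pose e : 'rV[R]_#|I| := \row_k d 0 (enum_val k).
have -> : principal_submx I (diag_mx d *m A) = diag_mx e *m principal_submx I A.
  by rewrite !mul_diag_mx; apply/matrixP=> k l; rewrite !mxE.
by rewrite det_mulmx det_diag; under eq_bigr => k _ do rewrite mxE.
Qed.

Lemma principal_minor_map (S : comNzRingType) (f : {rmorphism R -> S}) (n : nat)
    (I : {set 'I_n}) (A : 'M[R]_n) :
  principal_minor I (map_mx f A) = f (principal_minor I A).
Proof.
rewrite /principal_minor -det_map_mx; congr (\det _).
by apply/matrixP=> k l; rewrite !mxE.
Qed.

(** Laplace expansion along row [i], an identity row, leaves only the cofactor at [(i, i)]. This
    puts the numerator of Cramer's rule in the same form as the denominator. *)
Lemma adj_diag (n : nat) (B : 'M[R]_n) (i : 'I_n) :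
  (\adj B) i i =
  \det (\matrix_(k, l) (if k != i then B k l else (k == l)%:R)).
Proof.
rewrite (expand_det_row _ i) (bigD1 i) //= big1 => [|j neq_ji].
  rewrite !mxE !eqxx mul1r addr0 /cofactor; congr (_ * \det _).
  by apply/matrixP=> k l; rewrite !mxE eq_sym neq_lift.
by rewrite mxE eqxx /= eq_sym (negbTE neq_ji) mul0r.
Qed.

End PrincipalMinors.

Section Resolvent.

Variables (R : comNzRingType) (n : nat) (A : 'M[R]_n).

Let AX : 'M[{poly R}]_n := map_mx polyC A.
Let B : 'M[{poly R}]_n := 1%:M - 'X *: AX.

(** Evaluation at 0 is a ring morphism, so it commutes with the determinant, and it sends [B] to the
    identity. *)
Lemma det_one_sub_XA_coef0 : (\det B)`_0 = 1.
Proof.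
rewrite -horner_coef0 -[(\det B).[0]]/(horner_eval 0 (\det B)) -det_map_mx.
rewrite -[RHS](det1 R n); congr (\det _); apply/matrixP=> k l.
rewrite !mxE; move: (A k l) => a.
rewrite -[LHS]/(((k == l)%:R - 'X * a%:P).[0]) hornerD hornerN hornerM hornerX.
by rewrite mul0r subr0 -polyC_natr hornerC.
Qed.

Lemma scaleX_map_polyC_exp (j : nat) :
  ('X *: AX) ^+ j = 'X^j *: map_mx polyC (A ^+ j).
Proof.
elim: j => [|j IHj]; first by rewrite !expr0 scale1r map_mx1.
rewrite !exprS IHj -!mulmxE -scalemxAl -scalemxAr scalerA.
by rewrite -exprS map_mxM.
Qed.

Lemma expmx_diag_coef (i : 'I_n) (m : nat) :
  (A ^+ m) i i = ((\adj B) i i * \sum_(k < m.+1) (1 - \det B) ^+ k)`_m.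
Proof.
set D := \det B; set G := \sum_(k < m.+1) _.
(* Modulo ['X^(m.+1)], [S] is the inverse of [B] and [G] that of [D]. *)
pose S := \sum_(j < m.+1) ('X *: AX) ^+ j.
pose c := (\adj B *m map_mx polyC (A ^+ m.+1)) i i.
have BS : B *m S = 1%:M - 'X^(m.+1) *: map_mx polyC (A ^+ m.+1).
  by rewrite -scaleX_map_polyC_exp -opprB [X in - X]subrX1 -mulNr opprB.
have DS : D * S i i = (\adj B) i i - 'X^(m.+1) * c.
  have := congr1 (fun M : 'M_n => M i i) (mulmxA (\adj B) B S).
  rewrite mul_adj_mx mul_scalar_mx BS mulmxBr mulmx1 -scalemxAr.
  by rewrite [LHS]mxE [X in _ + X]mxE [X in - X]mxE [RHS]mxE.
(* As [1 - D] has constant term 0, its power of exponent [m.+1] is divisible by ['X^(m.+1)]. *)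
have [q Dq] : exists q, 1 - D = 'X * q.
  exists (\poly_(k < size (1 - D)) (1 - D)`_k.+1).
  apply/polyP=> -[|k]; rewrite coefXM /=.
    by rewrite coefB coef1 det_one_sub_XA_coef0 subrr.
  by rewrite coef_poly; case: ltnP => // le_k; rewrite nth_default // ltnW.
have DG : D * G = 1 - 'X^(m.+1) * q ^+ m.+1.
  rewrite -exprMn -Dq -[RHS]opprB subrX1 -mulNr opprB opprB.
  by rewrite addrCA subrr addr0.
have -> : (\adj B) i i * G =
    S i i + 'X^(m.+1) * (c * G - q ^+ m.+1 * S i i).
  have -> : (\adj B) i i = D * S i i + 'X^(m.+1) * c by rewrite DS subrK.
  rewrite mulrDl mulrAC DG mulrBl mul1r mulrBr !mulrA.
  by rewrite -addrA [- _ + _]addrC.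
(* The error term has no coefficient in degree [m], and in [S] only the summand [j = m] has one. *)
rewrite coefD coefXnM ltnSn addr0 /S summxE coef_sum.
rewrite (bigD1 ord_max) //= big1 => [|j neq_jm].
  by rewrite addr0 scaleX_map_polyC_exp !mxE coefXnM ltnn subnn coefC.
rewrite scaleX_map_polyC_exp !mxE coefMC coefXn.
by rewrite eq_sym -val_eqE /= in neq_jm *; rewrite (negbTE neq_jm) mul0r.
Qed.

End Resolvent.

Section GenericExpansion.

Variable n : nat.

Definition subset_number (I : {set 'I_n}) : 'I_(2 ^ n) :=
  cast_ord (card_subsets_ord n) (enum_rank I).

Lemma subset_numberK : cancel subset_number (@numbered_subset n).
Proof. by move=> I; rewrite /numbered_subset cast_ordK enum_rankK. Qed.

(* Since principal minors become indeterminates here, this is the polynomial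
   det(1 - X diag(1_J) A) for a generic A. *)
Definition generic_det (J : {set 'I_n}) : {poly {mpoly int[2 ^ n]}} :=
  \sum_(I : {set 'I_n})
    (\prod_(k in I) if k \in J then - 'X else 0) * ('X_(subset_number I))%:P.

Variables (R : comNzRingType) (A : 'M[R]_n).
Variable ev : {rmorphism {mpoly int[2 ^ n]} -> R}.
Hypothesis ev_minor : forall I, ev 'X_(subset_number I) = principal_minor I A.

(** Replacing the rows outside [J] by identity rows amounts to taking [1 + diag(d) A] with [d] equal
    to [- 'X] on [J] and 0 elsewhere, to which [det_add1] applies. *)
Lemma map_generic_det (J : {set 'I_n}) :
  map_poly ev (generic_det J) =
  \det (\matrix_(k, l) (if k \in J then (1%:M - 'X *: map_mx polyC A) k l
                        else (k == l)%:R)).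
Proof.
pose d : 'rV[{poly R}]_n := \row_k (if k \in J then - 'X else 0).
set M := \matrix_(k, l) _.
have -> : M = 1%:M + diag_mx d *m map_mx polyC A.
  rewrite mul_diag_mx; apply/matrixP=> k l; rewrite !mxE.
  by case: ifP => _; rewrite ?mulNr ?mul0r ?addr0.
rewrite det_add1 rmorph_sum; apply: eq_bigr => I _.
rewrite principal_minor_diag_mul principal_minor_map rmorphM /= map_polyC /=.
rewrite ev_minor rmorph_prod; congr (_ * _).
apply: eq_bigr => k _; rewrite mxE.
by case: ifP => _; rewrite ?rmorphN /= ?map_polyX ?rmorph0.
Qed.

(** The formula of [expmx_diag_coef] for generic minors: [[set~ i]] yields the adjugate entry,
    [setT] the determinant. *)
Definition diag_power_poly (i : 'I_n) (m : nat) : {mpoly int[2 ^ n]} :=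
  (generic_det [set~ i] *
   \sum_(k < m.+1) (1 - generic_det setT) ^+ k)`_m.

Lemma ev_diag_power_poly (i : 'I_n) (m : nat) :
  (A ^+ m) i i = ev (diag_power_poly i m).
Proof.
rewrite /diag_power_poly -coef_map rmorphM /= map_generic_det rmorph_sum /=.
under eq_bigr => k _ do rewrite rmorphXn rmorphB rmorph1 /= map_generic_det.
rewrite expmx_diag_coef adj_diag.
congr (polyseq (\det _ * _))`_m.
  by apply/matrixP=> k l; rewrite !mxE !inE.
apply: eq_bigr => k _; congr ((1 - \det _) ^+ k).
by apply/matrixP=> u v; rewrite !mxE inE.
Qed.

End GenericExpansion.

Lemma diag_power_poly_subst (n m : nat) (i : 'I_n) (R : comPzRingType)
    (A : 'M[R]_n) :
  (A ^+ m) i i =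
    subst_mpoly (fun k => principal_minor (numbered_subset k) A)
      (diag_power_poly i m).
Proof.
(* In the zero ring all elements are equal; otherwise [R] becomes a nonzero ring [S], over which
   substitution is the ring morphism [mmap intr]. *)
have [eq10|neq10] := eqVneq (1 : R) 0.
  by rewrite -[LHS]mulr1 -[RHS]mulr1 eq10 !mulr0.
pose nzR := GRing.PzSemiRing_isNonZero.Build R neq10.
pose S : comNzRingType := HB.pack R nzR.
pose ev : {rmorphism {mpoly int[2 ^ n]} -> S} :=
  mmap intr (fun k => principal_minor (R := S) (numbered_subset k) A).
have ev_minor I : ev 'X_(subset_number I) = principal_minor (R := S) I A.
  by rewrite /ev /= mmapX mmap1U subset_numberK.
exact: (ev_diag_power_poly ev_minor).
Qed.

Theorem theorem2p1 (n m : nat) (i : 'I_n) :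
  (exists P : {mpoly int[2 ^ n]},
     forall (R : comPzRingType) (A : 'M[R]_n),
       (A ^+ m) i i =
         subst_mpoly (fun k => principal_minor (numbered_subset k) A) P)
  /\ (forall (R : comPzRingType) (A B : 'M[R]_n),
        (forall I : {set 'I_n}, principal_minor I A = principal_minor I B) ->
        (A ^+ m) i i = (B ^+ m) i i).
Proof.
split.
  by exists (diag_power_poly i m) => R A; apply: diag_power_poly_subst.
move=> R A B eqAB; rewrite !diag_power_poly_subst.
apply: eq_bigr => u _; congr (_ * _).
by apply: eq_bigr => k _; rewrite eqAB.
Qed.
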